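(* Let $\nu=(\nu_s)_{s\ge1}$ and $\nu'=(\nu'_s)_{s\ge1}$ be sequences of complex numbers, each with only finitely many nonzero terms. Then, as formal power series in the infinitely many variables $w=(w_j)_{j\ge1}$, $$R(\nu\vert w)=\frac{K(\nu\vert w)}{K(0\vert w)}=\prod_{j\ge1}(1-v_j)^{-\gamma_j},$$ $$R(\nu\vert w)\,R(\nu'\vert w)=R(\nu+\nu'\vert w),$$ where $\nu+\nu'=(\nu_s+\nu'_s)_{s\ge1}$ and $\gamma_j=\gamma_j(\nu)=\sum_{k\ge1}\min(j,k)\nu_k$.
   Context: For $\nu$ as in the claim and a sequence $N=(N_m)_{m\ge1}$ of non-negative integers with finitely many nonzero terms put $$P_m=P_m(\nu,N)=\sum_{k\ge1}\min(m,k)\nu_k-2\sum_{k\ge1}\min(m,k)N_k,\qquad \mathcal{J}=\{j\ge1\mid N_j>0\}.$$ The binomial coefficient is $\binom{\xi}{n}=\xi(\xi-1)\cdots(\xi-n+1)/n!$ for $n\ge1$, $\binom{\xi}{0}=1$ ($\xi\in\mathbb{C}$). Define $$K(\nu,N)=\prod_{m\ge1}\binom{P_m+N_m}{N_m},$$ $$R(\nu,N)=\det_{m,k\in\mathcal{J}}\big(\delta_{m,k}P_m+2\min(m,k)N_k\big)\prod_{m\in\mathcal{J}}\frac1{N_m}\binom{P_m+N_m-1}{N_m-1}\quad(\mathcal{J}\neq\emptyset),$$ and $R(\nu,N)=1$ if $\mathcal{J}=\emptyset$. The generating functions are the formal power series $$R(\nu\vert w)=\sum_NR(\nu,N)\prod_{m\ge1}w_m^{N_m},\qquad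 K(\nu\vert w)=\sum_NK(\nu,N)\prod_{m\ge1}w_m^{N_m},$$ summed over all sequences $N$ of non-negative integers with finitely many nonzero terms; $K(0\vert w)$ is the case $\nu_s=0$ for all $s$. The $v_j$ ($j\ge1$) are the formal power series in $w$ without constant term determined by $$w_i=v_i\prod_{k\ge1}(1-v_k)^{-2\min(i,k)}\qquad(i\ge1).$$ *)

(* Defs.v *)
From HB Require Import structures.
From mathcomp Require Import all_boot all_order all_algebra finmap.
From mathcomp Require Import boolp classical_sets functions cardinality fsbigop.
From mathcomp Require Import reals complex.
From mathcomp.multinomials Require Import monalg.

Set Implicit Arguments.
Unset Strict Implicit.
Unset Printing Implicit Defensive.

Import GRing.Theory.

Local Open Scope classical_set_scope.
Local Open Scope ring_scope.

(* All families indexed by the positive integers (the variables w_j, the series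
   v_j, the sequences nu and N) are indexed by nat with a shift by one: index
   i : nat stands for i.+1.  In particular min(m, k) is minn m.+1 k.+1.

   A finitely supported sequence N of natural numbers is an element of
   {cmonom nat}, i.e. it is identified with the monomial \prod_m w_m ^ N_m;
   mmul adds exponents, and mone is the zero sequence. *)

Notation monom := {cmonom nat}.

Section Divisors.

Implicit Types m d e x y : monom.

Lemma finite_divisors m : finite_set [set d | exists e, mmul d e = m].
Proof.
pose mk (phi : {ffun finsupp m -> 'I_(mdeg m).+1}) : monom :=
  [cmonom (if insub i is Some j then nat_of_ord (phi j) else 0%N)
    | i in finsupp m]%M.
apply: (@sub_finite_set _ _ (mk @` setT)); last exact/finite_image/finite_finset.
move=> d [e de].
have le_d i : (d i <= m i)%N by rewrite -de cmM leq_addr.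
exists [ffun i : finsupp m => inord (d (val i))] => //.
apply/eqP/cmP => i; rewrite /mk cmE fsfun_fun.
case: ifPn => [im|]; last first.
  by rewrite -cmE_eq0 => /eqP mi0; move: (le_d i); rewrite mi0 leqn0 => /eqP.
rewrite (insubT (fun i => i \in finsupp m) im) ffunE /= inordK // ltnS.
apply: leq_trans (le_d i) _.
by rewrite mdegE (big_fsetD1 i) //= leq_addr.
Qed.

Lemma finite_factorizations m :
  finite_set [set p : monom * monom | mmul p.1 p.2 = m].
Proof.
apply: (@sub_finite_set _ _
  ([set d | exists e, mmul d e = m] `*` [set d | exists e, mmul d e = m])).
  move=> [x y] /= xy; split=> /=; first by exists y.
  by exists x; rewrite mulmC.
by apply: finite_setX; exact: finite_divisors.
Qed.

Definition divisors m : seq monom := fset_set [set d | exists e, mmul d e = m].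

Lemma mem_divisorsl x y m : mmul x y = m -> x \in divisors m.
Proof.
move=> xy; rewrite in_fset_set ?inE /=; last exact: finite_divisors.
by exists y.
Qed.

Lemma mem_divisorsr x y m : mmul x y = m -> y \in divisors m.
Proof. by move=> xy; apply: (@mem_divisorsl y x); rewrite mulmC. Qed.

Lemma divisors_uniq m : uniq (divisors m).
Proof. exact: fset_uniq. Qed.

End Divisors.

(* Formal power series in the variables w_i, i : nat, given by their
   coefficients. *)
Definition fps (F : Type) : Type := monom -> F.

HB.instance Definition _ (F : zmodType) :=
  GRing.Zmodule.copy (fps F) (monom -> F).

Section FpsRing.

Variable F : comNzRingType.
Implicit Types f g h : fps F.

Definition fps_one : fps F := fun m => (m == mone)%:R.

Definition fps_mul f g : fps F := fun m =>
  \sum_(p \in [set p : monom * monom | mmul p.1 p.2 = m]) f p.1 * g p.2.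

Lemma fps_mulE (s : seq monom) f g m : uniq s -> {subset divisors m <= s} ->
  fps_mul f g m =
  \sum_(x <- s) \sum_(y <- s) f x * g y *+ (mmul x y == m).
Proof.
move=> us sub; rewrite /fps_mul.
rewrite (_ : [set p | _] = [set` [pred p : monom * monom | mmul p.1 p.2 == m]]).
  rewrite -(@bigfs _ _ _ _ [seq (x, y) | x <- s, y <- s]) /=.
  - by rewrite big_mkcond big_allpairs /=; do 2!apply: eq_bigr => ? _; rewrite mulrb.
  - by rewrite allpairs_uniq // => -[x y] [x' y'].
  - move=> [x y] /= /eqP xy /negP[]; apply/allpairsP; exists (x, y) => /=.
    split=> //; apply: sub; first exact: mem_divisorsl xy.
    exact: mem_divisorsr xy.
by apply/seteqP; split=> p /= /eqP.
Qed.

Lemma fps_mulC : commutative fps_mul.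
Proof.
move=> f g; apply/funext => m.
rewrite !(@fps_mulE (divisors m)) ?divisors_uniq // exchange_big /=.
by do 2!apply: eq_bigr => ? _; rewrite mulrC mulmC.
Qed.

Lemma fps_mul1 : left_id fps_one fps_mul.
Proof.
move=> f; apply/funext => m; have div1m := @mem_divisorsl mone m m (mul1m m).
rewrite (@fps_mulE (divisors m)) ?divisors_uniq // (bigD1_seq mone) //=;
  last exact: divisors_uniq.
rewrite (bigD1_seq m) /= ?divisors_uniq //;
  last exact: mem_divisorsr (mul1m m).
rewrite /fps_one !eqxx mul1m eqxx mul1r big1 ?addr0.
  rewrite big1 ?addr0 // => x /negPf x1; apply: big1 => y _.
  by rewrite x1 mul0r mul0rn.
by move=> y /negPf ym; rewrite mul1m ym.
Qed.

Lemma fps_mulDl : left_distributive fps_mul +%R.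
Proof.
move=> f g h; apply/funext => m.
change (fps_mul (f + g) h m = fps_mul f h m + fps_mul g h m).
rewrite !(@fps_mulE (divisors m)) ?divisors_uniq // -big_split /=.
apply: eq_bigr => x _; rewrite -big_split /=; apply: eq_bigr => y _.
by rewrite -mulrnDl -mulrDl.
Qed.

Lemma divisors_trans x y m :
  x \in divisors y -> y \in divisors m -> x \in divisors m.
Proof.
rewrite !in_fset_set ?inE /=; try exact: finite_divisors.
by move=> [e <-] [e' <-]; exists (mmul e e'); rewrite mulmA.
Qed.

Lemma fps_mulA : associative fps_mul.
Proof.
move=> f g h; apply/funext => m; set s := divisors m.
have us : uniq s by exact: divisors_uniq.
have subs x : x \in s -> {subset divisors x <= s}.
  by move=> xs y yx; exact: divisors_trans xs.
transitivity (\sum_(x <- s) \sum_(y <- s) \sum_(z <- s)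
    f x * g y * h z *+ (mmul (mmul x y) z == m)); last first.
  rewrite (@fps_mulE s) //; transitivity (\sum_(z <- s) \sum_(t <- s)
    fps_mul f g t * h z *+ (mmul t z == m)); last by rewrite exchange_big.
  under [LHS]eq_bigr do rewrite exchange_big.
  rewrite exchange_big /=; apply: eq_big_seq => z zs.
  rewrite [RHS](eq_big_seq (fun t => \sum_(x <- s) \sum_(y <- s)
    f x * g y * h z *+ ((mmul x y == t) && (mmul t z == m)))); last first.
    move=> t ts; rewrite (@fps_mulE s) //; last exact: subs.
    rewrite mulr_suml -sumrMnl; apply: eq_bigr => x _.
    rewrite mulr_suml -sumrMnl; apply: eq_bigr => y _.
    by rewrite mulrnAl -mulrnA mulnb.
  rewrite [RHS]exchange_big /=; apply: eq_big_seq => x xs.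
  rewrite [RHS]exchange_big /=; apply: eq_big_seq => y ys.
  have [xyzm|xyzm] := boolP (mmul (mmul x y) z == m); last first.
    rewrite mulr0n big1 // => t _.
    by case: eqP => [<-|]; rewrite /= ?(negPf xyzm) mulr0n.
  have xys : mmul x y \in s by apply: mem_divisorsl (eqP xyzm).
  rewrite (bigD1_seq _ xys us) /= eqxx xyzm big1 ?addr0 // => t.
  by rewrite eq_sym => /negPf ->.
rewrite (@fps_mulE s) //; apply: eq_big_seq => x xs.
rewrite [LHS](eq_big_seq (fun t => \sum_(y <- s) \sum_(z <- s)
    f x * g y * h z *+ ((mmul y z == t) && (mmul x t == m)))); last first.
  move=> t ts; rewrite (@fps_mulE s) //; last exact: subs.
  rewrite mulr_sumr -sumrMnl; apply: eq_bigr => y _.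
  rewrite mulr_sumr -sumrMnl; apply: eq_bigr => z _.
  by rewrite mulrnAr mulrA -mulrnA mulnb.
rewrite [LHS]exchange_big /=; apply: eq_big_seq => y ys.
rewrite [LHS]exchange_big /=; apply: eq_big_seq => z zs.
rewrite -mulmA.
have [xyzm|xyzm] := boolP (mmul x (mmul y z) == m); last first.
  rewrite mulr0n big1 // => t _.
  by case: eqP => [<-|]; rewrite /= ?(negPf xyzm) mulr0n.
have yzs : mmul y z \in s by apply: mem_divisorsr (eqP xyzm).
rewrite (bigD1_seq _ yzs us) /= eqxx xyzm big1 ?addr0 // => t.
by rewrite eq_sym => /negPf ->.
Qed.

Lemma fps_one_neq0 : fps_one != 0.
Proof.
apply/eqP => /(congr1 (fun f : fps F => f mone)); rewrite /fps_one eqxx.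
by move/eqP; rewrite oner_eq0.
Qed.

HB.instance Definition _ := GRing.Zmodule_isComNzRing.Build (fps F)
  fps_mulA fps_mulC fps_mul1 fps_mulDl fps_one_neq0.

Definition fps_unit : pred (fps F) := fun f => `[< exists g, g * f = 1 >].

Definition fps_inv (f : fps F) : fps F :=
  if pselect (exists g, g * f = 1) is left e then projT1 (cid e) else f.

Lemma fps_mulVr : {in fps_unit, left_inverse 1 fps_inv *%R}.
Proof.
move=> f /asboolP ef; rewrite /fps_inv.
by case: pselect => // e; case: cid.
Qed.

Lemma fps_unitPl (f g : fps F) : g * f = 1 -> fps_unit f.
Proof. by move=> gf; apply/asboolP; exists g. Qed.

Lemma fps_invr_out : {in [predC fps_unit], fps_inv =1 id}.
Proof.
move=> f /negP nf; rewrite /fps_inv; case: pselect => // e.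
by exfalso; apply: nf; apply/asboolP.
Qed.

HB.instance Definition _ := GRing.ComNzRing_hasMulInverse.Build (fps F)
  fps_mulVr fps_unitPl fps_invr_out.

Definition fps_var (i : nat) : fps F := fun m => (m == ucm i)%:R.

(* \prod_j A j = f, the product converging coefficientwise: each coefficient of
   the partial products is eventually constant. *)
Definition fps_infprod (A : nat -> fps F) (f : fps F) : Prop :=
  forall m, exists n0, forall n, (n0 <= n)%N -> (\prod_(j < n) A j) m = f m.

(* The family v is determined by its implicit equations
   w_i = v_i * \prod_k (1 - v_k) ^ (- 2 min(i, k)). *)
Definition fps_v_system (v : nat -> fps F) : Prop :=
  (forall j, v j mone = 0) /\
  (forall i, exists2 f, fps_infprod
      (fun k => (1 - v k) ^- (2 * minn i.+1 k.+1)) f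
    & fps_var i = v i * f).

End FpsRing.

Arguments fps_var {F} i.

Section GeneratingFunctions.

Variable F : fieldType.
Implicit Types (nu : nat -> F) (N : monom).

Definition gbinom (x : F) (n : nat) : F := (\prod_(i < n) (x - i%:R)) / n`!%:R.

(* f ^ a := \sum_n gbinom a n * (f - 1) ^ n, for a series f with constant
   term 1; then for each monomial only finitely many n contribute. *)
Definition fps_pow (f : fps F) (a : F) : fps F := fun m =>
  \sum_(n \in [set: nat]) gbinom a n * ((f - 1) ^+ n) m.

Definition gamma nu (j : nat) : F :=
  \sum_(k \in [set: nat]) (minn j.+1 k.+1)%:R * nu k.

Definition Pvac nu N (m : nat) : F :=
  \sum_(k \in [set: nat]) (minn m.+1 k.+1)%:R * nu k
  - 2%:R * \sum_(k <- finsupp N) (minn m.+1 k.+1 * N k)%:R.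

(* The factors with N m = 0 are equal to 1. *)
Definition Kcoef nu N : F :=
  \prod_(m <- finsupp N) gbinom (Pvac nu N m + (N m)%:R) (N m).

(* finsupp N is the index set J; when it is empty the determinant is that of the
   empty matrix, so the value is 1. *)
Definition Rcoef nu N : F :=
  let J : seq nat := finsupp N in
  \det (\matrix_(a < size J, b < size J)
      let m := nth 0%N J a in let k := nth 0%N J b in
      (m == k)%:R * Pvac nu N m + (2 * minn m.+1 k.+1 * N k)%:R)
  * \prod_(m <- J)
      ((N m)%:R^-1 * gbinom (Pvac nu N m + (N m)%:R - 1) (N m).-1).

Definition Kgen nu : fps F := fun N => Kcoef nu N.

Definition Rgen nu : fps F := fun N => Rcoef nu N.

End GeneratingFunctions.

(* Main.v *)
(* The coefficients depend on nu only through g = gamma(nu), so let g be an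
   arbitrary sequence.  Writing e_j for the j-th unit sequence and
   A_j k = 2 min(j, k), Pascal's rule gives, for D = K and for D = R (there with
   multilinearity of the determinant in its j-th column),
     D(g) = D(g - e_j) + w_j * D(g - A_j).
   A family with coefficients polynomial in g that satisfies this recurrence and
   vanishes at g = 0 is zero.  The rows of the matrix in R sum to g_m, so R(0) = 1,
   and hence R(g) R(h) = R(g + h) and R(g) K(0) = K(g).  The recurrence for R at
   g = A_j then reads w_j = (1 - R(-e_j)) R(A_j), so v_j = 1 - R(-e_j) solves the
   defining system; and (1 - v_j)^(-a) = R(a e_j), because both sides are
   polynomial in a and agree when -a is a natural number. *)

Require Import Defs.
From mathcomp Require Import all_boot all_order perm all_algebra finmap.
From mathcomp Require Import boolp classical_sets functions cardinality fsbigop.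
From mathcomp Require Import reals complex.
From mathcomp.multinomials Require Import monalg.
From mathcomp Require Import ring zify.

Set Implicit Arguments.
Unset Strict Implicit.
Unset Printing Implicit Defensive.

Import GRing.Theory Num.Theory.

Local Open Scope classical_set_scope.
Local Open Scope ring_scope.

(** * Functions given by polynomials *)

Section PolynomialFunctions.

Variable F : numFieldType.
Implicit Types (h : F -> F) (x : F).

Definition polyfun h : Prop := exists p : {poly F}, forall t, h t = p.[t].

Lemma polyfunC x : polyfun (fun=> x).
Proof. by exists x%:P => t; rewrite hornerC. Qed.

Lemma polyfun_id : polyfun id.
Proof. by exists 'X => t; rewrite hornerX. Qed.

Lemma polyfunD h1 h2 :
  polyfun h1 -> polyfun h2 -> polyfun (fun t => h1 t + h2 t).
Proof.
by move=> [p1 e1] [p2 e2]; exists (p1 + p2) => t; rewrite hornerD e1 e2.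
Qed.

Lemma polyfunM h1 h2 :
  polyfun h1 -> polyfun h2 -> polyfun (fun t => h1 t * h2 t).
Proof.
by move=> [p1 e1] [p2 e2]; exists (p1 * p2) => t; rewrite hornerM e1 e2.
Qed.

Lemma polyfunB h1 h2 :
  polyfun h1 -> polyfun h2 -> polyfun (fun t => h1 t - h2 t).
Proof.
by move=> [p1 e1] [p2 e2]; exists (p1 - p2) => t; rewrite hornerD hornerN e1 e2.
Qed.

Lemma polyfun_comp h1 h2 :
  polyfun h1 -> polyfun h2 -> polyfun (fun t => h1 (h2 t)).
Proof.
by move=> [p1 e1] [p2 e2]; exists (p1 \Po p2) => t; rewrite horner_comp -e2.
Qed.

Lemma polyfun_sum (I : Type) (r : seq I) (P : pred I) (h : I -> F -> F) :
  (forall i, polyfun (h i)) -> polyfun (fun t => \sum_(i <- r | P i) h i t).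
Proof.
move=> /choice[p e]; exists (\sum_(i <- r | P i) p i) => t.
by rewrite horner_sum; apply: eq_bigr.
Qed.

Lemma polyfun_prod (I : Type) (r : seq I) (P : pred I) (h : I -> F -> F) :
  (forall i, polyfun (h i)) -> polyfun (fun t => \prod_(i <- r | P i) h i t).
Proof.
move=> /choice[p e]; exists (\prod_(i <- r | P i) p i) => t.
by rewrite horner_prod; apply: eq_bigr.
Qed.

(** In characteristic zero, 0, 1, 2, ... are distinct roots, more than the degree of a nonzero
    polynomial allows. *)
Lemma polyfun_eq0 h :
  polyfun h -> (forall n : nat, h n%:R = 0) -> forall t, h t = 0.
Proof.
move=> [p e] h0 t; rewrite e; suff -> : p = 0 by rewrite horner0.
apply/eqP; apply: contraT => p0.
have := max_poly_roots p0 (rs := [seq n%:R | n <- iota 0 (size p)]).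
rewrite size_map size_iota ltnn => -> //.
  by apply/allP => _ /mapP[n _ ->]; apply/rootP; rewrite -e.
by rewrite map_inj_uniq ?iota_uniq // => m n /eqP; rewrite eqr_nat => /eqP.
Qed.

Lemma polyfun_eq h1 h2 : polyfun h1 -> polyfun h2 ->
  (forall n : nat, h1 n%:R = h2 n%:R) -> h1 =1 h2.
Proof.
move=> p1 p2 h12 t; apply/eqP; rewrite -subr_eq0; apply/eqP.
apply: (polyfun_eq0 (h := fun t => h1 t - h2 t)); first exact: polyfunB.
by move=> n; rewrite h12 subrr.
Qed.

(** Period 1 forces the value [h 0] at every natural number, and these values determine the
    polynomial. *)
Lemma polyfun_periodic h :
  polyfun h -> (forall t, h t = h (t - 1)) -> forall t, h t = h 0.
Proof.
move=> ph per; apply: polyfun_eq => //; first exact: polyfunC.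
by elim=> // n IHn; rewrite per -natr1 addrK.
Qed.

Lemma polyfun_gbinom n : polyfun (fun x => gbinom x n).
Proof.
apply: polyfunM; last exact: polyfunC.
apply: polyfun_prod => i.
by apply: polyfunB; [exact: polyfun_id|exact: polyfunC].
Qed.

Lemma polyfun_gbinom_comp h n : polyfun h -> polyfun (fun t => gbinom (h t) n).
Proof. exact: polyfun_comp (polyfun_gbinom n). Qed.

Lemma polyfun_det n (A : F -> 'M[F]_n) :
  (forall i j, polyfun (fun t => A t i j)) -> polyfun (fun t => \det (A t)).
Proof.
move=> pA; apply: polyfun_sum => s; apply: polyfunM; first exact: polyfunC.
exact: polyfun_prod.
Qed.

End PolynomialFunctions.

(** * Binomial coefficients with arbitrary upper argument *)

Section GeneralizedBinomial.

Variable F : numFieldType.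
Implicit Types (x : F) (n : nat).

Lemma gbinom0 x : gbinom x 0 = 1.
Proof. by rewrite /gbinom big_ord0 fact0 divr1. Qed.

Lemma gbinomS x n : gbinom x n.+1 = gbinom x n * (x - n%:R) / n.+1%:R.
Proof.
rewrite /gbinom big_ord_recr /= factS natrM.
by field; rewrite nat1r !pnatr_eq0 /= -lt0n fact_gt0.
Qed.

Lemma gbinom_pascal x n : gbinom (x + 1) n.+1 = gbinom x n.+1 + gbinom x n.
Proof.
elim: n => [|n IHn].
  by rewrite !gbinomS !gbinom0 /=; field.
rewrite gbinomS IHn !(gbinomS _ n.+1) gbinomS.
have nz k : k.+1%:R != 0 :> F by rewrite pnatr_eq0.
have e1 : n.+1%:R = n%:R + 1 :> F by rewrite -natr1.
have e2 : n.+2%:R = n%:R + 1 + 1 :> F by rewrite -!natr1.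
have := nz n; have := nz n.+1; rewrite e1 e2 => nz2 nz1.
by field; rewrite nz1.
Qed.

Lemma gbinom_nat m n : gbinom m%:R n = 'C(m, n)%:R :> F.
Proof.
elim: m n => [|m IHm] [|n]; rewrite ?gbinom0 ?bin0 //.
  by rewrite /gbinom big_ord_recl subrr !mul0r bin0n.
by rewrite -natr1 gbinom_pascal !IHm binS natrD.
Qed.

End GeneralizedBinomial.

(** * Coefficients of products of series *)

Section Coefficients.

Variable F : numFieldType.
Implicit Types (f g : fps F) (m x y : monom).

Lemma fps_coefM (s : seq monom) f g m :
  uniq s -> {subset Defs.divisors m <= s} ->
  (f * g) m = \sum_(x <- s) \sum_(y <- s) f x * g y *+ (mmul x y == m).
Proof. exact: fps_mulE. Qed.

Lemma fps_coefMd f g m : (f * g) m =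
  \sum_(x <- Defs.divisors m) \sum_(y <- Defs.divisors m)
    f x * g y *+ (mmul x y == m).
Proof. by apply: fps_coefM => //; exact: Defs.divisors_uniq. Qed.

Lemma mem_divisorsP x m :
  reflect (exists y, mmul x y = m) (x \in Defs.divisors m).
Proof.
apply: (iffP idP) => [|[y xy]]; last exact: mem_divisorsl xy.
by rewrite in_fset_set ?inE //; exact: finite_divisors.
Qed.

Lemma fps_coefM0 f g : (f * g) mone = f mone * g mone.
Proof.
rewrite (@fps_coefM [:: mone]) //.
  by rewrite !big_seq1 mul1m eqxx.
by move=> x /mem_divisorsP[y /eqP]; rewrite cmM_eq1 inE => /andP[].
Qed.

Lemma fps_coef1 : (1 : fps F) mone = 1.
Proof. by rewrite -[LHS]/((mone == mone)%:R) eqxx. Qed.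

Lemma fps_coefX0 f n : f mone = 1 -> (f ^+ n) mone = 1.
Proof.
move=> f1; elim: n => [|n IHn]; first exact: fps_coef1.
by rewrite exprS fps_coefM0 f1 IHn mulr1.
Qed.

Lemma ucmM_inj (j : nat) : injective (mmul (ucm j) : monom -> monom).
Proof.
move=> x y /eqP/cmP xy; apply/eqP/cmP => i.
by move: (xy i); rewrite !cmM => /addnI.
Qed.

Lemma fps_coef_varM j f m : (fps_var j * f) (mmul (ucm j) m) = f m.
Proof.
have ud := @Defs.divisors_uniq (mmul (ucm j) m).
rewrite fps_coefMd (bigD1_seq (ucm j)) //=; last exact: mem_divisorsl.
rewrite [X in _ + X]big1 ?addr0 => [|x /negPf xj]; last first.
  by apply: big1 => y _; rewrite /fps_var xj mul0r mul0rn.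
rewrite (bigD1_seq m) //=; last exact: mem_divisorsr.
rewrite eqxx /fps_var eqxx mul1r big1 ?addr0 // => y /negPf ym.
by rewrite (inj_eq (@ucmM_inj j)) ym.
Qed.

Lemma fps_coef_varM0 j f m : m j = 0%N -> (fps_var j * f) m = 0.
Proof.
move=> mj; rewrite fps_coefMd; apply: big1 => x _; apply: big1 => y _.
rewrite /fps_var; case: (x =P ucm j) => [->|]; last by rewrite mul0r mul0rn.
by case: eqP => // e; move: mj; rewrite -e cmM cmUU.
Qed.

(** Supplies the case split for a coefficient of w_j f: [fps_coef_varM0] covers the monomials
    without w_j, [fps_coef_varM] those divisible by it. *)
Lemma ucm_factor j m : m j != 0%N -> exists m', m = mmul (ucm j) m'.
Proof.
move=> mj; exists (divcm m (ucm j)); apply/eqP/cmP => i.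
rewrite cmM divcmE cmU; case: eqP => [<-|_]; last by rewrite add0n subn0.
by rewrite add1n subn1 prednK // lt0n.
Qed.

End Coefficients.

(** * Filtration by total degree *)

Section Order.

Variable F : numFieldType.
Implicit Types (f g : fps F) (m : monom).

Definition fps_order_ge d f : Prop := forall m, (mdeg m < d)%N -> f m = 0.

Lemma fps_order_ge0 f : fps_order_ge 0 f.
Proof. by []. Qed.

Lemma fps_order_geM d e f g :
  fps_order_ge d f -> fps_order_ge e g -> fps_order_ge (d + e) (f * g).
Proof.
move=> fd ge m lem; rewrite fps_coefMd; apply: big1 => x _; apply: big1 => y _.
case: eqP => // xy; move: lem; rewrite -xy mdegM => lem.
have [/fd->|dx] := ltnP (mdeg x) d; first by rewrite mul0r.
by rewrite ge ?mulr0 //; lia.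
Qed.

Lemma fps_order_geMl d f g : fps_order_ge d f -> fps_order_ge d (f * g).
Proof. by move=> fd; rewrite -[d]addn0; apply: fps_order_geM. Qed.

Lemma fps_order_geD d f g :
  fps_order_ge d f -> fps_order_ge d g -> fps_order_ge d (f + g).
Proof.
by move=> fd gd m md; change (f m + g m = 0); rewrite fd ?gd ?addr0.
Qed.

Lemma fps_order_geX f n : f mone = 0 -> fps_order_ge n (f ^+ n).
Proof.
move=> f0; elim: n => // n IHn; rewrite exprS -add1n.
apply: fps_order_geM => // m.
by rewrite ltnS leqn0 mdeg_eq0 => /eqP->.
Qed.

Lemma fps_order_ge_prodB d n (A B : nat -> fps F) :
  (forall k, fps_order_ge d (A k - B k)) ->
  fps_order_ge d (\prod_(k < n) A k - \prod_(k < n) B k).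
Proof.
move=> dAB; elim: n => [|n IHn]; first by rewrite !big_ord0 subrr.
rewrite !big_ord_recr /=.
set a := \prod_(k < n) A k; set b := \prod_(k < n) B k.
(* Telescoping: one factor is exchanged at a time. *)
have -> : a * A n - b * B n = (a - b) * A n + (A n - B n) * b by ring.
by apply: fps_order_geD; apply: fps_order_geMl.
Qed.

Lemma fps_infprod_order d (A B : nat -> fps F) f g :
  fps_infprod A f -> fps_infprod B g ->
  (forall k, fps_order_ge d (A k - B k)) -> fps_order_ge d (f - g).
Proof.
move=> Af Bg dAB m md.
have [n1 Af1] := Af m; have [n2 Bg2] := Bg m.
set n := maxn n1 n2; have := fps_order_ge_prodB n dAB md.
change ((\prod_(k < n) A k) m - (\prod_(k < n) B k) m = 0 -> f m - g m = 0).
by rewrite Af1 ?Bg2 // ?leq_maxl ?leq_maxr.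
Qed.

End Order.

(** * Powers with arbitrary exponent *)

Section Power.

Variable F : numFieldType.
Implicit Types (f g : fps F) (a : F) (m : monom).

(** Since [f - 1] has no constant term, its n-th power has order at least n. The cutoff [k] does not
    depend on [a], so each coefficient is polynomial in the exponent. *)
Lemma fps_powE f a m k : f mone = 1 -> (mdeg m < k)%N ->
  fps_pow f a m = \sum_(n < k) gbinom a n * ((f - 1) ^+ n) m.
Proof.
move=> f1 mk; rewrite /fps_pow (fsbigE (iota 0 k)) ?iota_uniq //.
  rewrite (eq_bigl xpredT) => [|i]; last exact/asboolP.
  by rewrite -(big_mkord xpredT (fun n => gbinom a n * ((f - 1) ^+ n) m))
    /index_iota subn0.
move=> n _; rewrite mem_iota -leqNgt => kn.
rewrite (@fps_order_geX _ _ n) ?mulr0 //; last by move: kn mk; lia.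
by change (f mone - (1 : fps F) mone = 0); rewrite f1 fps_coef1 subrr.
Qed.

Lemma fps_pow_nat f n : f mone = 1 -> fps_pow f n%:R = f ^+ n.
Proof.
move=> f1; apply/funext => m; set h := f - 1.
(* The cutoff exceeds both the degree of [m] and [n]: the first n + 1 terms form the binomial
   expansion of (1 + h)^n, and the later binomials vanish. *)
rewrite (@fps_powE _ _ _ (n.+1 + (mdeg m).+1)) //; last by lia.
rewrite -/h big_split_ord /= [X in _ + X]big1 ?addr0 => [|i _]; last first.
  by rewrite gbinom_nat bin_small ?mul0r //= leq_addr.
have -> : f = 1 + h by rewrite addrC subrK.
rewrite exprDn.
rewrite (big_morph (fun g : fps F => g m) (id1 := 0) (op1 := +%R)) //.
apply: eq_bigr => i _; rewrite gbinom_nat expr1n mul1r mulr_natl.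
by elim: 'C(n, i) => // k IHk; rewrite !mulrSr IHk.
Qed.

Lemma polyfun_fps_pow f m : f mone = 1 -> polyfun (fun a => fps_pow f a m).
Proof.
move=> f1.
have [p e] : polyfun (fun a => \sum_(n < (mdeg m).+1)
    gbinom a n * ((f - 1) ^+ n) m).
  apply: polyfun_sum => n; apply: polyfunM; last exact: polyfunC.
  exact: polyfun_gbinom.
by exists p => a; rewrite -e; apply: fps_powE.
Qed.

Lemma polyfun_coefM (f g : F -> fps F) m :
  (forall x, polyfun (fun t => f t x)) ->
  (forall x, polyfun (fun t => g t x)) ->
  polyfun (fun t => (f t * g t) m).
Proof.
move=> pf pg.
have [p e] : polyfun (fun t => \sum_(x <- Defs.divisors m)
    \sum_(y <- Defs.divisors m) f t x * g t y * (mmul x y == m)%:R).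
  apply: polyfun_sum => x; apply: polyfun_sum => y.
  by apply: polyfunM; [exact: polyfunM|exact: polyfunC].
exists p => t; rewrite -e fps_coefMd; apply: eq_bigr => x _.
by apply: eq_bigr => y _; rewrite mulr_natr.
Qed.

(** Coefficientwise both sides are polynomial in [a], so natural exponents suffice. The case a = -1
    then yields inverses of series with constant term 1. *)
Lemma fps_powD1 f a : f mone = 1 -> fps_pow f (a + 1) = fps_pow f a * f.
Proof.
move=> f1; apply/funext => m; move: a.
apply: (@polyfun_eq _ (fun a => fps_pow f (a + 1) m)
  (fun a => (fps_pow f a * f) m)) => [||n].
- apply: (polyfun_comp (polyfun_fps_pow m f1)).
  by apply: polyfunD; [exact: polyfun_id|exact: polyfunC].
- apply: polyfun_coefM => x; first exact: polyfun_fps_pow.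
  exact: polyfunC.
- by rewrite natr1 !fps_pow_nat // exprSr.
Qed.

Lemma fps_unit_coef1 f : f mone = 1 -> f \is a GRing.unit.
Proof.
move=> f1; apply/asboolP; exists (fps_pow f (- 1)).
by rewrite -fps_powD1 // addNr -[0]/(0%:R) fps_pow_nat // expr0.
Qed.

Lemma fps_coefV0 f : f mone = 1 -> f^-1 mone = 1.
Proof.
move=> f1; rewrite -[LHS]mulr1 -f1 -fps_coefM0 mulVr ?fps_coef1 //.
exact: fps_unit_coef1.
Qed.

Lemma fps_order_geV d f g : f mone = 1 -> g mone = 1 ->
  fps_order_ge d (f - g) -> fps_order_ge d (f^-1 - g^-1).
Proof.
move=> f1 g1 fg.
have uf := fps_unit_coef1 f1; have ug := fps_unit_coef1 g1.
have -> : f^-1 - g^-1 = (f - g) * (- (f^-1 * g^-1)).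
  by rewrite mulrN mulrBl mulrA divrr // mul1r mulrCA divrr // mulr1 opprB.
exact: fps_order_geMl.
Qed.

End Power.

(** * Families governed by the recurrence *)

Section Families.

Variable F : numFieldType.
Implicit Types (g h : nat -> F) (D : (nat -> F) -> fps F) (N : monom).

Definition delta_seq (j : nat) : nat -> F := fun k => (k == j)%:R.

Definition interaction (j : nat) : nat -> F :=
  fun k => (2 * minn j.+1 k.+1)%:R.

(** Polynomiality is asked along coordinate lines only, because coordinates of [g] get changed one
    at a time; locality leaves finitely many of them to change for each monomial. *)
Record regular_family D : Prop := RegularFamily {
  family_rec : forall g j,
    D g = D (g - delta_seq j) + fps_var j * D (g - interaction j);
  family_local : forall g h N,
    {in finsupp N, g =1 h} -> D g N = D h N;
  family_poly : forall g j N,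
    polyfun (fun t => D (fun k => g k + t * delta_seq j k) N) }.

(** The recurrence is linear over the ring of series; locality survives because a divisor of [N] has
    its support inside that of [N]. *)
Lemma regular_family_mulr D (f : fps F) :
  regular_family D -> regular_family (fun g => D g * f).
Proof.
case=> rec loc pol; split=> [g j|g h N gh|g j N].
- by rewrite {1}(rec g j) mulrDl mulrA.
- rewrite !fps_coefMd; apply: eq_bigr => x _; apply: eq_bigr => y _.
  case: eqP => // xy; congr (_ * _ *+ _); apply: loc => i ix; apply: gh.
  by move: ix; rewrite -xy -!cmE_neq0 cmM; lia.
- by apply: polyfun_coefM => x; [exact: pol|exact: polyfunC].
Qed.

Lemma regular_family_sub D1 D2 : regular_family D1 -> regular_family D2 ->
  regular_family (fun g => D1 g - D2 g).
Proof.
case=> rec1 loc1 pol1 [rec2 loc2 pol2]; split=> [g j|g h N gh|g j N].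
- by rewrite {1}(rec1 g j) {1}(rec2 g j) mulrBr opprD addrACA.
- change (D1 g N - D2 g N = D1 h N - D2 h N).
  by rewrite (loc1 _ _ _ gh) (loc2 _ _ _ gh).
- exact: (polyfunB (pol1 g j N) (pol2 g j N)).
Qed.

Lemma regular_family_shift D h :
  regular_family D -> regular_family (fun g => D (g + h)).
Proof.
case=> rec loc pol; split=> [g j|g g' N gg'|g j N].
- by rewrite {1}(rec (g + h) j) ![g + h - _]addrAC.
- by apply: loc => i iN; rewrite !fctE gg'.
- have [p e] := pol (g + h) j N; exists p => t; rewrite -e.
  by congr (D _ N); apply/funext => k; rewrite !fctE addrAC.
Qed.

(* The recurrence lowers the degree in [w] up to a shift of [g], so by induction
   each coefficient is a polynomial in [g] periodic in every coordinate, hence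
   constant. *)
Lemma regular_family_eq0 D : regular_family D -> D 0 = 0 -> forall g, D g = 0.
Proof.
case=> rec loc pol D0 g; apply/funext => N.
have [d] := ubnP (mdeg N); elim: d => // d IHd in g N * => ltNd.
have shift j h : D h N = D (h - delta_seq j) N.
  rewrite {1}(rec h j).
  change (D (h - delta_seq j) N + (fps_var j * D (h - interaction j)) N
    = D (h - delta_seq j) N).
  have [Nj|/ucm_factor[M eN]] := eqVneq (N j) 0%N.
    by rewrite fps_coef_varM0 // addr0.
  rewrite -[RHS]addr0; congr (_ + _); rewrite eN fps_coef_varM.
  by apply: IHd; move: ltNd; rewrite eN mdegM mdegU add1n ltnS.
have move_coord j h t : D (fun k => h k + t * delta_seq j k) N = D h N.
  rewrite (polyfun_periodic (pol h j N)).
    by congr (D _ N); apply/funext => k; rewrite mul0r addr0.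
  move=> {}t; rewrite (shift j); congr (D _ N); apply/funext => k.
  by rewrite !fctE mulrBl mul1r addrA.
have kill (s : seq nat) : D (fun k => if k \in s then 0 else g k) N = D g N.
  elim: s => [|j s <-]; first by congr (D _ N); apply/funext.
  set h := fun k => if k \in s then _ else _.
  rewrite -(move_coord j h (- h j)); congr (D _ N); apply/funext => k.
  rewrite /h /delta_seq inE; case: eqP => [->|_] /=.
    by rewrite mulr1 subrr.
  by rewrite mulr0 addr0.
(* Once [g] is annihilated on the support of [N], locality no longer distinguishes it from 0. *)
rewrite -(kill (finsupp N)) -[RHS]/((0 : fps F) N) -D0; apply: loc => k kN.
by rewrite kN.
Qed.

End Families.

(** * Determinants indexed by lists *)

Section ListDeterminant.

Variable F : fieldType.
Implicit Types (s t : seq nat) (f h : nat -> nat -> F).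

(** Rows and columns are named by the entries of [s] instead of positions, so that index sets can be
    reordered and enlarged. *)
Definition seq_det s f : F :=
  \det (\matrix_(a < size s, b < size s) f (nth 0%N s a) (nth 0%N s b)).

Lemma eq_seq_det s f h : {in s &, forall i k, f i k = h i k} ->
  seq_det s f = seq_det s h.
Proof.
move=> fh; congr (\det _); apply/matrixP => a b.
by rewrite !mxE fh // mem_nth ?ltn_ord.
Qed.

(** Rows and columns undergo the same permutation, so its sign occurs twice and cancels. *)
Lemma seq_det_perm s t f : uniq s -> perm_eq s t -> seq_det s f = seq_det t f.
Proof.
move=> us st; have szst := perm_size st.
have [n szs] : exists n, size s = n by exists (size s).
have szt : size t = n by rewrite -szst.
rewrite /seq_det szs szt.
have mem (c : 'I_n) : nth 0%N t c \in s.
  by rewrite (perm_mem st) mem_nth ?szt ?ltn_ord.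
have ltst (a : 'I_n) : (index (nth 0%N t a) s < n)%N.
  by rewrite -[X in (_ < X)%N]szs index_mem.
have inj : injective (fun a => Ordinal (ltst a)).
  move=> a b /(congr1 val)/= e; apply/val_inj/eqP => /=.
  rewrite -(nth_uniq 0%N (s := t)) ?szt -?(perm_uniq st) //.
  by rewrite -(nth_index 0%N (mem a)) e nth_index.
pose p := perm inj; set A := (X in \det X = _); set B := (X in _ = \det X).
have -> : B = row_perm p (col_perm p A).
  by apply/matrixP => a b; rewrite !mxE !permE /= !nth_index.
rewrite row_permE col_permE !det_mulmx !det_perm mulrCA.
by rewrite odd_permV -signr_addb addbb mulr1.
Qed.

Lemma seq_det_cons j s f : f j j = 1 -> {in s, forall i, f i j = 0} ->
  seq_det (j :: s) f = seq_det s f.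
Proof.
move=> fj fs; rewrite /seq_det /= (expand_det_col _ ord0) big_ord_recl mxE.
rewrite /= fj.
rewrite mul1r big1 ?addr0 => [|i _]; last first.
  by rewrite mxE /= fs ?mul0r // mem_nth ?ltn_ord.
rewrite /cofactor expr0 mul1r; congr (\det _); apply/matrixP => a b.
by rewrite !mxE.
Qed.

(** The indices outside [t] are moved to the front; their columns are unit vectors and are removed
    in turn by expansion along the first column. *)
Lemma seq_det_extend s t f : uniq s -> uniq t -> {subset t <= s} ->
  (forall i k, i \in s -> k \notin t -> f i k = (i == k)%:R) ->
  seq_det s f = seq_det t f.
Proof.
move=> us ut ts ft; pose r := [seq x <- s | x \notin t].
have st : perm_eq s (r ++ t).
  apply: uniq_perm => // [|x].
    rewrite cat_uniq filter_uniq // ut andbT; apply/hasPn => x xt.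
    by rewrite mem_filter xt.
  rewrite mem_cat mem_filter.
  by case: (boolP (x \in t)) => [/ts->|]; rewrite ?orbT ?orbF.
rewrite (seq_det_perm f us st).
have : uniq (r ++ t) by rewrite -(perm_uniq st).
have : {subset r <= s} by move=> x; rewrite mem_filter => /andP[].
have : all [pred x | x \notin t] r by apply: filter_all.
elim: r {st} => //= j r IHr /andP[jt rt] rs /andP[jrt urt].
have js : j \in s by apply: rs; rewrite mem_head.
have {}rs : {subset r <= s} by move=> x xr; apply: rs; rewrite inE xr orbT.
rewrite seq_det_cons ?IHr //; first by rewrite ft ?eqxx.
move=> i irt; rewrite ft //.
  by case: eqP irt => // ->; rewrite (negPf jrt).
by move: irt; rewrite mem_cat => /orP[/rs|/ts].
Qed.

Lemma seq_det_scale s f (c : nat -> F) :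
  seq_det s (fun i k => f i k * c k) = seq_det s f * \prod_(k <- s) c k.
Proof.
rewrite (big_nth 0%N) big_mkord.
pose d : 'rV[F]_(size s) := \row_b c (nth 0%N s b).
have -> : \prod_(b < size s) c (nth 0%N s b) = \det (diag_mx d).
  by rewrite det_diag; apply: eq_bigr => b _; rewrite mxE.
rewrite -det_mulmx; congr (\det _); apply/matrixP => a b.
by rewrite mul_mx_diag !mxE.
Qed.

Lemma seq_det_addcol s j f g h : uniq s -> j \in s ->
  (forall i, f i j = g i j + h i j) ->
  (forall i k, k != j -> f i k = g i k) ->
  (forall i k, k != j -> f i k = h i k) ->
  seq_det s f = seq_det s g + seq_det s h.
Proof.
move=> us js fj fg fh; have ltj : (index j s < size s)%N by rewrite index_mem.
pose a := Ordinal ltj.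
have nj (b : 'I_(size s).-1) : nth 0%N s (lift a b) != j.
  rewrite -[X in _ != X](nth_index 0%N js) nth_uniq // ?ltn_ord //.
  by rewrite eq_sym -[index j s]/(val a) (inj_eq val_inj) neq_lift.
(* Multilinearity is available for rows, hence the transposes; the factors 1 are the coefficients of
   the linear combination. *)
rewrite /seq_det -[LHS]det_tr -[X in _ = X + _]det_tr -[X in _ = _ + X]det_tr.
rewrite -[X in _ = X + _]mul1r -[X in _ = _ + X]mul1r.
apply: (determinant_multilinear (i0 := a)).
- by apply/rowP => b; rewrite !mxE !mul1r /= nth_index.
- by apply/matrixP => b c; rewrite !mxE fg.
- by apply/matrixP => b c; rewrite !mxE fh.
Qed.

(** The all-ones vector lies in the kernel. *)
Lemma seq_det_eq0 s f : s != [::] ->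
  {in s, forall i, \sum_(k <- s) f i k = 0} -> seq_det s f = 0.
Proof.
move=> s0 fs; rewrite /seq_det -det_tr; apply/eqP/det0P.
have lt0 : (0 < size s)%N by rewrite lt0n size_eq0.
exists (const_mx 1).
  apply/eqP => /rowP/(_ (Ordinal lt0))/eqP.
  by rewrite !mxE oner_eq0.
apply/rowP => a; rewrite !mxE -[RHS](fs (nth 0%N s a)) ?mem_nth ?ltn_ord //.
rewrite (big_nth 0%N) big_mkord; apply: eq_bigr => b _.
by rewrite !mxE mul1r.
Qed.

End ListDeterminant.

(** Lets expressions over the supports of two different monomials be compared over one common
    list. *)
Lemma big_seq_support (T : Type) (idx : T) (op : Monoid.com_law idx)
    (I : eqType) (s t : seq I) (f : I -> T) :
  uniq s -> uniq t -> {subset t <= s} ->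
  {in s, forall i, i \notin t -> f i = idx} ->
  \big[op/idx]_(i <- s) f i = \big[op/idx]_(i <- t) f i.
Proof.
move=> us ut ts ft.
rewrite (bigID (mem t)) /= [X in op _ X]big1_seq ?Monoid.mulm1.
  rewrite -big_filter; apply/perm_big/uniq_perm; rewrite ?filter_uniq //.
  by move=> i; rewrite mem_filter; case: (boolP (i \in t)) => // /ts->.
by move=> i /andP[it si]; apply: ft.
Qed.

(** * Vacancy numbers for an arbitrary sequence g *)

Section VacancyNumbers.

Variable F : numFieldType.
Implicit Types (g h : nat -> F) (N M : monom).

Definition vacancy g N (m : nat) : F :=
  g m - 2%:R * \sum_(k <- finsupp N) (minn m.+1 k.+1 * N k)%:R.

Lemma vacancy_sub_delta g N j m :
  vacancy (g - delta_seq F j) N m = vacancy g N m - (m == j)%:R.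
Proof. by rewrite /vacancy !fctE /delta_seq addrAC. Qed.

Lemma supp_ucmM j M : {subset finsupp M <= finsupp (mmul (ucm j) M)}.
Proof. by move=> i; rewrite mdomD in_fsetU orbC => ->. Qed.

Lemma mem_supp_ucmM j M : j \in finsupp (mmul (ucm j) M).
Proof. by rewrite -cmE_neq0 cmM cmUU. Qed.

Lemma ucmM_diag j M : mmul (ucm j) M j = (M j).+1.
Proof. by rewrite cmM cmUU. Qed.

Lemma ucmM_off j M i : i != j -> mmul (ucm j) M i = M i.
Proof. by rewrite eq_sym cmM cmU => /negPf->. Qed.

(* Removing one [w_j] from the monomial is compensated, for every vacancy number
   at once, by the shift of [g] that appears in the recurrence. *)
Lemma vacancy_ucmM g j M m :
  vacancy g (mmul (ucm j) M) m = vacancy (g - interaction F j) M m.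
Proof.
rewrite /vacancy !fctE /interaction -addrA; congr (_ + _).
set s := finsupp _.
rewrite -[in RHS](@big_seq_support _ _ _ _ s) ?fset_uniq //; first last.
- by move=> i _; rewrite -cmE_eq0 => /eqP->; rewrite muln0.
- exact: supp_ucmM.
rewrite (bigD1_seq j) ?mem_supp_ucmM ?fset_uniq //=.
rewrite [in RHS](bigD1_seq j) ?mem_supp_ucmM ?fset_uniq //=.
rewrite ucmM_diag (eq_bigr (fun k => (minn m.+1 k.+1 * M k)%:R)); last first.
  by move=> i ij; rewrite ucmM_off.
by rewrite mulnS (minnC j.+1) !natrD natrM; ring.
Qed.

Lemma eq_vacancy g h N m : g m = h m -> vacancy g N m = vacancy h N m.
Proof. by rewrite /vacancy => ->. Qed.

Lemma polyfun_vacancy g j N m :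
  polyfun (fun t => vacancy (fun k => g k + t * delta_seq F j k) N m).
Proof.
apply: polyfunB; last exact: polyfunC.
apply: polyfunD; first exact: polyfunC.
by apply: polyfunM; [exact: polyfun_id|exact: polyfunC].
Qed.

(** * The series K and its recurrence *)

Definition K_series g : fps F := fun N =>
  \prod_(m <- finsupp N) gbinom (vacancy g N m + (N m)%:R) (N m).

Lemma K_series_supp (s : seq nat) g N : uniq s -> {subset finsupp N <= s} ->
  K_series g N = \prod_(m <- s) gbinom (vacancy g N m + (N m)%:R) (N m).
Proof.
move=> us sub.
rewrite [RHS](@big_seq_support _ _ _ _ s (finsupp N)) ?fset_uniq //.
by move=> i _; rewrite -cmE_eq0 => /eqP->; rewrite gbinom0.
Qed.

Lemma K_series_coef1 g : K_series g mone = 1.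
Proof. by rewrite (@K_series_supp [::]) ?big_nil // => i; rewrite mdom1. Qed.

Lemma K_series_regular : regular_family K_series.
Proof.
split=> [g j|g h N gh|g j N].
- apply/funext => N.
  change (K_series g N = K_series (g - delta_seq F j) N
    + (fps_var j * K_series (g - interaction F j)) N).
  (* If w_j does not divide the monomial, the shift by e_j affects only the vacancy number at [j],
     which does not occur in the product. *)
  have [Nj|/ucm_factor[M ->]] := eqVneq (N j) 0%N.
    rewrite fps_coef_varM0 // addr0; apply: eq_big_seq => m mN.
    rewrite vacancy_sub_delta; case: eqP mN => [->|_]; last by rewrite subr0.
    by rewrite -cmE_neq0 Nj.
  rewrite fps_coef_varM; set s := finsupp (mmul (ucm j) M).
  rewrite !(@K_series_supp s) ?fset_uniq //; last exact: supp_ucmM.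
  rewrite !(bigD1_seq j) ?mem_supp_ucmM ?fset_uniq //= ucmM_diag -vacancy_ucmM.
  (* Pascal's rule splits the factor at [j]; the remaining factors are the same in all three
     terms. *)
  rewrite vacancy_sub_delta eqxx mulr1n -natr1 addrA gbinom_pascal mulrDl.
  congr (_ * _ + _ * _); first by congr (gbinom _ _); ring.
    by apply: eq_bigr => i /negPf ij; rewrite vacancy_sub_delta ij subr0.
  by apply: eq_bigr => i ij; rewrite -vacancy_ucmM ucmM_off.
- by apply: eq_big_seq => m mN; rewrite (@eq_vacancy _ h) // gh.
- apply: polyfun_prod => m; apply: polyfun_gbinom_comp; apply: polyfunD.
    exact: polyfun_vacancy.
  exact: polyfunC.
Qed.

(** * The series R and its recurrence *)

Definition R_series g : fps F := fun N =>
  seq_det (finsupp N) (fun m k =>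
    (m == k)%:R * vacancy g N m + (2 * minn m.+1 k.+1 * N k)%:R)
  * \prod_(m <- finsupp N)
      ((N m)%:R^-1 * gbinom (vacancy g N m + (N m)%:R - 1) (N m).-1).

(* The factor of [a] is binom(x + n - 1, n - 1), with binom(_, -1) = 0, so that the
   column of an index outside the support is a unit vector. *)
Definition det_entry (delta a x : F) (n : nat) : F :=
  delta * gbinom (x + n%:R - 1) n
  + a * (if n is n'.+1 then gbinom (x + n'%:R) n' else 0).

(** Pascal's rule in both binomials; for [n] = 0 the convention binom(_, -1) = 0 keeps it valid. *)
Lemma det_entryS delta a x n :
  det_entry delta a x n.+1
  = det_entry delta a (x - 1) n.+1 + det_entry delta a x n.
Proof.
have e y k : y + k.+1%:R - 1 = y + k%:R :> F by rewrite -natr1 addrA addrK.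
rewrite /det_entry !e addrACA -!mulrDr; congr (_ * _ + _ * _).
  by rewrite -[in LHS](subrK 1 (x + _)) gbinom_pascal addrAC.
case: n => [|n]; first by rewrite !gbinom0 addr0.
have -> : x - 1 + n.+1%:R = x + n%:R by rewrite -natr1; ring.
by rewrite -natr1 addrA gbinom_pascal.
Qed.

(** Rests on the absorption identity x binom(x + n, n) / (n + 1) = binom(x + n, n + 1). *)
Lemma det_entry_fact delta a x n :
  (delta * x + a * n.+1%:R) * (n.+1%:R^-1 * gbinom (x + n.+1%:R - 1) n)
  = det_entry delta a x n.+1.
Proof.
have e : x + n.+1%:R - 1 = x + n%:R by rewrite -natr1 addrA addrK.
by rewrite /det_entry e gbinomS addrK; field; rewrite nat1r pnatr_eq0.
Qed.

(** Each factor of the product is absorbed into its column, which removes the division by N_k; the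
    columns added outside the support are unit vectors. *)
Lemma R_series_supp (s : seq nat) g N : uniq s -> {subset finsupp N <= s} ->
  R_series g N = seq_det s (fun m k => det_entry (m == k)%:R
    (2 * minn m.+1 k.+1)%:R (vacancy g N k) (N k)).
Proof.
move=> us sub.
rewrite (seq_det_extend us (fset_uniq (finsupp N)) sub); last first.
  move=> i k _; rewrite -cmE_eq0 => /eqP->.
  by rewrite /det_entry gbinom0 mulr1 mulr0 addr0.
rewrite /R_series -seq_det_scale; apply: eq_seq_det => m k _.
rewrite -cmE_neq0; case: (N k) => // n _.
rewrite natrM -det_entry_fact; congr ((_ + _) * _).
by case: eqP => [->|]; rewrite ?mul0r.
Qed.

Lemma R_series_coef1 g : R_series g mone = 1.
Proof.
rewrite (@R_series_supp [::]) //; first exact: det_mx00.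
by move=> i; rewrite mdom1.
Qed.

Lemma R_series0 : R_series 0 = 1.
Proof.
apply/funext => N; have [->|N1] := eqVneq N mone.
  by rewrite R_series_coef1 fps_coef1.
rewrite -[RHS]/((N == mone)%:R) (negPf N1) /R_series seq_det_eq0 ?mul0r //.
  apply: contraNneq N1 => e; rewrite -mdeg_eq0 mdegE e; by rewrite big_nil.
(* In the sum of row [m] the subtracted part of the vacancy number cancels, leaving g_m = 0. *)
move=> m mN; rewrite big_split /= (bigD1_seq m) ?fset_uniq //= eqxx mul1r.
rewrite big1 => [|k /negPf km]; last by rewrite eq_sym km mul0r.
rewrite addr0 /vacancy sub0r addrC; apply/eqP; rewrite subr_eq0; apply/eqP.
by rewrite mulr_sumr; apply: eq_bigr => k _; rewrite -mulnA natrM.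
Qed.

Lemma R_series_regular : regular_family R_series.
Proof.
split=> [g j|g h N gh|g j N].
- apply/funext => N.
  change (R_series g N = R_series (g - delta_seq F j) N
    + (fps_var j * R_series (g - interaction F j)) N).
  have [Nj|/ucm_factor[M ->]] := eqVneq (N j) 0%N.
    rewrite fps_coef_varM0 // addr0 !(@R_series_supp (finsupp N)) ?fset_uniq //.
    apply: eq_seq_det => m k _ kN.
    have /negPf kj : k != j by apply: contraTneq kN => ->; rewrite -cmE_neq0 Nj.
    by rewrite vacancy_sub_delta kj subr0.
  rewrite fps_coef_varM; set s := finsupp (mmul (ucm j) M).
  rewrite !(@R_series_supp s) ?fset_uniq //; last exact: supp_ucmM.
  (* Over the common list [s] the three matrices differ only in column [j]. *)
  apply: (@seq_det_addcol _ _ j); rewrite ?mem_supp_ucmM ?fset_uniq //.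
  + move=> i; rewrite -vacancy_ucmM vacancy_sub_delta eqxx mulr1n ucmM_diag.
    exact: det_entryS.
  + by move=> i k /negPf kj; rewrite vacancy_sub_delta kj subr0.
  + by move=> i k kj; rewrite -vacancy_ucmM ucmM_off.
- rewrite !(@R_series_supp (finsupp N)) ?fset_uniq //.
  by apply: eq_seq_det => m k _ kN; rewrite (@eq_vacancy _ h) // gh.
- apply: polyfunM.
    apply: polyfun_det => a b; under [X in polyfun X]eq_fun do rewrite mxE.
    apply: polyfunD; last exact: polyfunC.
    by apply: polyfunM; [exact: polyfunC|exact: polyfun_vacancy].
  apply: polyfun_prod => m; apply: polyfunM; first exact: polyfunC.
  apply: polyfun_gbinom_comp; apply: polyfunD; last exact: polyfunC.
  apply: polyfunD; last exact: polyfunC.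
  exact: polyfun_vacancy.
Qed.

(** * Multiplicativity of R and its consequences *)

Lemma R_seriesD g h : R_series (g + h) = R_series g * R_series h.
Proof.
apply/esym/eqP; rewrite -subr_eq0; apply/eqP; move: g.
(* For fixed [h] the difference is a regular family in [g], and it vanishes at 0 because R(0) =
   1. *)
apply: (@regular_family_eq0 _
  (fun g => R_series g * R_series h - R_series (g + h))).
  apply: regular_family_sub; first exact: regular_family_mulr R_series_regular.
  exact: regular_family_shift R_series_regular.
by rewrite R_series0 mul1r add0r subrr.
Qed.

Lemma R_series_mulK g : R_series g * K_series 0 = K_series g.
Proof.
apply/eqP; rewrite -subr_eq0; apply/eqP; move: g.
apply: (@regular_family_eq0 _ (fun g => R_series g * K_series 0 - K_series g)).
  apply: regular_family_sub; last exact: K_series_regular.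
  exact: regular_family_mulr R_series_regular.
by rewrite R_series0 mul1r subrr.
Qed.

Lemma R_seriesMn g n : R_series (g *+ n) = R_series g ^+ n.
Proof.
elim: n => [|n IHn]; first by rewrite mulr0n R_series0.
by rewrite mulrS R_seriesD IHn exprS.
Qed.

Lemma R_series_sum (I : Type) (r : seq I) (g : I -> nat -> F) :
  R_series (\sum_(i <- r) g i) = \prod_(i <- r) R_series (g i).
Proof. exact: (big_morph _ R_seriesD R_series0). Qed.

Lemma R_seriesN g : R_series (- g) = (R_series g)^-1.
Proof.
apply: (mulIr (fps_unit_coef1 (R_series_coef1 g))).
rewrite -R_seriesD addNr R_series0 mulVr //.
exact/fps_unit_coef1/R_series_coef1.
Qed.

Lemma fps_pow_R_series j a :
  fps_pow (R_series (- delta_seq F j)) (- a)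
  = R_series (fun k => a * delta_seq F j k).
Proof.
(* The sign of [a] is reversed so that natural values of the new variable give ordinary powers of
   R(-e_j). *)
rewrite -[a in RHS]opprK; move: (- a) => {}a; apply/funext => N; move: a.
have R1 := R_series_coef1 (- delta_seq F j).
apply: (@polyfun_eq _ (fun a => fps_pow _ a N)
  (fun a => R_series (fun k => - a * delta_seq F j k) N)) => [||n].
- exact: polyfun_fps_pow.
- have [p e] := family_poly R_series_regular 0 j N.
  apply: (@polyfun_comp _
    (fun a => R_series (fun k => a * delta_seq F j k) N) -%R).
    exists p => t; rewrite -e; congr (R_series _ N).
    by apply/funext => k; rewrite add0r.
  by exists (- 'X) => t; rewrite hornerN hornerX.
- rewrite fps_pow_nat // -R_seriesMn; congr (R_series _ N); apply/funext => k.
  by rewrite natmulfctE opprfctE /= mulNr mulr_natl mulNrn.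
Qed.

(** A partial product is R of a truncation of [g]; once the truncation reaches past the support of
    [N], locality makes the coefficient final. *)
Lemma R_series_infprod g :
  fps_infprod (fun j => R_series (fun k => g j * delta_seq F j k)) (R_series g).
Proof.
move=> N; exists (\max_(i <- finsupp N) i).+1 => n ltn.
rewrite -R_series_sum; apply: (family_local R_series_regular) => i iN.
have lti : (i < n)%N by apply: leq_trans ltn; rewrite ltnS leq_bigmax_seq.
rewrite fct_sumE (bigD1 (Ordinal lti)) //= /delta_seq eqxx mulr1 big1 ?addr0 //.
by move=> j /negPf; rewrite -val_eqE eq_sym /= => ->; rewrite mulr0.
Qed.

(** * Existence and uniqueness of the series v *)

Definition v_series (j : nat) : fps F := 1 - R_series (- delta_seq F j).

Lemma v_seriesK j : 1 - v_series j = R_series (- delta_seq F j).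
Proof. by rewrite /v_series opprB addrC subrK. Qed.

Lemma v_series_system : fps_v_system v_series.
Proof.
split=> [j|i].
  change ((1 : fps F) mone - R_series (- delta_seq F j) mone = 0).
  by rewrite R_series_coef1 fps_coef1 subrr.
(* The k-th factor is R(-e_k) to the power -2 min(i, k), that is R(A_i(k) e_k), so the infinite
   product is R(A_i). *)
exists (R_series (interaction F i)).
  have := R_series_infprod (interaction F i); congr fps_infprod.
  apply/funext => k; rewrite v_seriesK -R_seriesMn -R_seriesN; congr R_series.
  apply/funext => l.
  rewrite opprfctE natmulfctE opprfctE /= mulNrn opprK.
  by rewrite /interaction mulr_natl.
rewrite /v_series mulrBl mul1r -R_seriesD.
rewrite {1}(family_rec R_series_regular (interaction F i) i) subrr R_series0.
by rewrite mulr1 [- delta_seq F i + _]addrC addrAC subrr add0r.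
Qed.

Lemma fps_infprod_coef1 (A : nat -> fps F) f :
  (forall k, A k mone = 1) -> fps_infprod A f -> f mone = 1.
Proof.
move=> A1 /(_ mone)[n /(_ n (leqnn n))<-].
elim: n => [|n IHn]; first by rewrite big_ord0 fps_coef1.
by rewrite big_ord_recr /= fps_coefM0 IHn A1 mulr1.
Qed.

(** A contraction argument: v_i is w_i times the inverse of a product built from the v_k, so
    agreement below degree d improves to agreement below degree d + 1. *)
Lemma fps_v_system_unique (v v' : nat -> fps F) :
  fps_v_system v -> fps_v_system v' -> v = v'.
Proof.
move=> [v0 vE] [v'0 v'E].
have cst1 (u : nat -> fps F) k : (forall j, u j mone = 0) -> (1 - u k) mone = 1.
  move=> u0; change ((1 : fps F) mone - u k mone = 1).
  by rewrite fps_coef1 u0 subr0.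
have solve i (u : nat -> fps F) f : (forall j, u j mone = 0) ->
    fps_infprod (fun k => (1 - u k) ^- (2 * minn i.+1 k.+1)) f ->
    fps_var i = u i * f -> f mone = 1 /\ u i = fps_var i * f^-1.
  move=> u0 uf ->; have f1 : f mone = 1.
    by apply: fps_infprod_coef1 uf => k; rewrite fps_coefV0 // fps_coefX0 ?cst1.
  by split=> //; rewrite mulrK // fps_unit_coef1.
suff vv' d j : fps_order_ge d (v j - v' j).
  apply/funext => j; apply/funext => m; apply/eqP; rewrite -subr_eq0; apply/eqP.
  exact: vv' (leqnn (mdeg m).+1).
elim: d j => [|d IHd] i; first exact: fps_order_ge0.
have [f vf eqf] := vE i; have [f' vf' eqf'] := v'E i.
have [f1 ->] := solve i v f v0 vf eqf.
have [f'1 ->] := solve i v' f' v'0 vf' eqf'.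
(* The factor w_i supplies the gain of one degree. *)
rewrite -mulrBr -add1n; apply: fps_order_geM.
  move=> m; rewrite ltnS leqn0 mdeg_eq0 => /eqP->.
  by rewrite /fps_var eq_sym cm1_eq1.
apply: fps_order_geV => //; apply: fps_infprod_order vf vf' _ => k.
apply: fps_order_geV; rewrite ?fps_coefX0 ?cst1 //.
rewrite subrXX; apply: fps_order_geMl.
have -> : 1 - v k - (1 - v' k) = (v k - v' k) * (- 1) by ring.
exact: fps_order_geMl.
Qed.

End VacancyNumbers.

(** * Return to the parameters nu *)

Section VacancyParameters.

Variable F : numFieldType.
Implicit Types nu : nat -> F.

Lemma gammaD nu nu' :
  finite_set [set s | nu s != 0] -> finite_set [set s | nu' s != 0] ->
  gamma (nu \+ nu') = gamma nu + gamma nu'.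
Proof.
move=> fnu fnu'; apply/funext => j.
(* All three sums are taken over the finite union of the supports, where additivity holds
   termwise. *)
have fU : finite_set ([set s | nu s != 0] `|` [set s | nu' s != 0]).
  by rewrite finite_setU.
have zero k :
    k \notin fset_set ([set s | nu s != 0] `|` [set s | nu' s != 0]) ->
    nu k = 0 /\ nu' k = 0.
  rewrite in_fset_set // => kU.
  by split; apply: contraNeq kU => nz; rewrite inE; [left|right].
rewrite addrfctE /gamma !(fsbigTE (fset_set
  ([set s | nu s != 0] `|` [set s | nu' s != 0]))).
- by rewrite -big_split; apply: eq_bigr => k _; rewrite mulrDr.
- by move=> k /zero[_ ->]; rewrite mulr0.
- by move=> k /zero[-> _]; rewrite mulr0.
- by move=> k /zero[e e']; rewrite /= e e' addr0 mulr0.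
Qed.

Lemma gamma0 : gamma (fun=> 0 : F) = 0.
Proof. by apply/funext => j; apply: fsbig1 => k _; rewrite mulr0. Qed.

(** By conversion, [Pvac nu N] is [vacancy (gamma nu) N]. *)
Lemma KgenE nu : Kgen nu = K_series (gamma nu).
Proof. by []. Qed.

Lemma RgenE nu : Rgen nu = R_series (gamma nu).
Proof. by []. Qed.

End VacancyParameters.

Theorem theorem4p5 (R : realType) (nu nu' : nat -> R[i])
    (fin_nu : finite_set [set s | nu s != 0])
    (fin_nu' : finite_set [set s | nu' s != 0]) :
  [/\ exists! v : nat -> fps R[i], fps_v_system v,
      Kgen (fun=> 0 : R[i]) \is a GRing.unit,
      Rgen nu = Kgen nu / Kgen (fun=> 0),
      forall v : nat -> fps R[i], fps_v_system v ->
        fps_infprod (fun j => fps_pow (1 - v j) (- gamma nu j)) (Rgen nu)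
    & Rgen nu * Rgen nu' = Rgen (nu \+ nu')].
Proof.
have K0_unit : Kgen (fun=> 0 : R[i]) \is a GRing.unit.
  by rewrite KgenE; apply/fps_unit_coef1/K_series_coef1.
split=> //.
- exists (@v_series R[i]); split; first exact: v_series_system.
  by move=> v; apply: fps_v_system_unique; exact: v_series_system.
- apply: (mulIr K0_unit); rewrite mulrVK //.
  by rewrite RgenE !KgenE gamma0 R_series_mulK.
(* Uniqueness replaces [v] by the explicit solution, for which (1 - v_j)^(-gamma_j) = R(gamma_j
   e_j). *)
- move=> v /fps_v_system_unique/(_ (@v_series_system R[i]))->.
  rewrite RgenE; have := R_series_infprod (gamma nu); congr fps_infprod.
  by apply/funext => j; rewrite v_seriesK fps_pow_R_series.
- by rewrite !RgenE -R_seriesD gammaD.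
Qed.
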